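(* Let $X,Y$ be random variables on $\mathcal M$ with Fréchet means $\mu,\nu$, satisfying the standing assumptions in the context, and let $p$ be a point on the geodesic $\alpha$ from $\mu$ to $\nu$. Then the Riemannian correlation coefficient satisfies $\mathcal R_{X,Y}(p)\in[-1,1]$.
   Context: $\mathcal M$ is a complete, compact, finite-dimensional Riemannian manifold with distance $d$, Riemannian logarithm map $\log_p$, and injectivity radius $\operatorname{inj}\mathcal M$. The Fréchet mean of a random variable $Z$ on $\mathcal M$ is the minimizer of $x\mapsto \mathbb E[d^2(x,Z)]$. Standing assumptions. (1) $X$ and $Y$ have unique Fréchet means $\mu$ and $\nu$; to ensure this, each of $X$ and $Y$ (every dataset drawn from it) is bounded in an open geodesic ball $B_r(p_0)$ (the balls may differ) with $r\le \frac12\min\{\operatorname{inj}\mathcal M,\pi/\sqrt\kappa\}$, where $\kappa$ is an upper bound on the sectional curvature; if $\kappa\le 0$, then $r$ must simply be finite. (2) $d(\mu,\nu)<\operatorname{inj}\mathcal M$, so that there is a unique minimizing geodesic $\alpha:[0,1]\to\mathcal M$ from $\mu$ to $\nu$. For points $p_1,p_2$ on $\alpha$, $\Gamma_{p_1}^{p_2}:T_{p_1}\mathcal M\to T_{p_2}\mathcal M$ is Levi-Civita parallel transport along $\alpha$. For $p\in\alpha$, $$\Sigma_{X,Y}(p)=\mathbb E\big[(\Gamma_\mu^p\log_\mu X)(\Gamma_\nu^p\log_\nu Y)^T\big],\qquad \operatorname{Cov}_{X,Y}(p)=\operatorname{tr}(\Sigma_{X,Y}(p)),$$ where tangent vectors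 in $T_p\mathcal M$ are written in coordinates of an orthonormal basis (so $uv^T$ is the operator $w\mapsto\langle v,w\rangle_p u$). $\operatorname{Cov}_{X,X}(\mu)=\operatorname{tr}\mathbb E[(\log_\mu X)(\log_\mu X)^T]$, and similarly $\operatorname{Cov}_{Y,Y}(\nu)$. The Riemannian correlation coefficient is $$\mathcal R_{X,Y}(p)=\frac{\operatorname{Cov}_{X,Y}(p)}{\sqrt{\operatorname{Cov}_{X,X}(\mu)}\sqrt{\operatorname{Cov}_{Y,Y}(\nu)}}.$$ *)

(* Defs.v *)
From HB Require Import structures.
From mathcomp Require Import all_boot all_order all_algebra.
From mathcomp Require Import all_classical all_reals all_analysis.

Set Implicit Arguments.
Unset Strict Implicit.
Unset Printing Implicit Defensive.

Import Order.TTheory GRing.Theory Num.Theory.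
Import numFieldNormedType.Exports.

Local Open Scope classical_set_scope.
Local Open Scope ring_scope.

Section smooth_maps.
Context {R : realType} {V W : normedModType R}.

(* [A] is meant to be open. *)
Fixpoint Ck_on (k : nat) (A : set V) (f : V -> W) : Prop :=
  match k with
  | 0 => forall x, A x -> {for x, continuous f}
  | k'.+1 => (forall x, A x -> differentiable f x) /\
             (forall v : V, Ck_on k' A (fun x => 'D_v f x))
  end.

Definition smooth_on (A : set V) (f : V -> W) : Prop :=
  forall k, Ck_on k A f.

End smooth_maps.

Record smoothAtlas (R : realType) (n : nat) (M : topologicalType) := SmoothAtlas {
  chart_index : Type;
  chart_dom : chart_index -> set M;
  chart : chart_index -> M -> 'rV[R]_n;
  chart_inv : chart_index -> 'rV[R]_n -> M;
  chart_at : M -> chart_index;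
  chart_atP : forall p, chart_dom (chart_at p) p;
  chart_dom_open : forall c, open (chart_dom c);
  chart_image_open : forall c, open (chart c @` chart_dom c);
  chartK : forall c p, chart_dom c p -> chart_inv c (chart c p) = p;
  chart_continuous : forall c p, chart_dom c p -> {for p, continuous (chart c)};
  chart_inv_continuous : forall c x, (chart c @` chart_dom c) x ->
    {for x, continuous (chart_inv c)};
  chart_smooth : forall c c',
    smooth_on (chart c @` (chart_dom c `&` chart_dom c'))
              (chart c' \o chart_inv c)
}.

Section tangent_vectors.
Context {R : realType} {n : nat} {M : topologicalType} (A : smoothAtlas R n M).

(* The tangent space at [p] is modelled by ['rV[R]_n]: a tangent vector at [p]
   is given by its components in the preferred chart [chart_at A p].
   [tangent_coord c c' p] turns components in [c] into components in [c']. *)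
Definition tangent_coord (c c' : chart_index A) (p : M) (v : 'rV[R]_n) : 'rV[R]_n :=
  'd (chart c' \o chart_inv c) (chart c p) v.

(* Only restrictions to [0, 1] matter for lengths; any C^1 curve on [0, 1]
   extends to a C^1 curve on the whole real line. *)
Definition C1_curve (g : R -> M) : Prop :=
  continuous g /\
  forall t (c : chart_index A), chart_dom c (g t) ->
    derivable (chart c \o g) t 1 /\ {for t, continuous (derive1 (chart c \o g))}.

Definition velocity (g : R -> M) (t : R) : 'rV[R]_n :=
  derive1 (chart (chart_at A (g t)) \o g) t.

Definition diffeo_onto_open (U : set 'rV[R]_n) (f : 'rV[R]_n -> M) : Prop :=
  [/\ open U, set_inj U f, open (f @` U),
      (forall v, U v -> {for v, continuous f}) /\
      (forall c : chart_index A, smooth_on (U `&` f @^-1` chart_dom c) (chart c \o f))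
    & exists2 h : M -> 'rV[R]_n, (forall v, U v -> h (f v) = v) &
      forall c : chart_index A,
        smooth_on (chart c @` (chart_dom c `&` f @` U)) (h \o chart_inv c)].

(* [m p] is the Gram matrix of the metric on the tangent space at [p], hence
   with respect to the coordinate frame of the preferred chart at [p]. *)
Definition inner (m : M -> 'M[R]_n) (p : M) (u v : 'rV[R]_n) : R :=
  (u *m m p *m v^T) 0 0.

Definition tnorm (m : M -> 'M[R]_n) (p : M) (v : 'rV[R]_n) : R :=
  Num.sqrt (inner m p v v).

Definition metric_coef (m : M -> 'M[R]_n) (c : chart_index A) (x : 'rV[R]_n) : 'M[R]_n :=
  let p := chart_inv c x in
  \matrix_(i, j) inner m p (tangent_coord c (chart_at A p) p (delta_mx 0 i))
                           (tangent_coord c (chart_at A p) p (delta_mx 0 j)).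

Definition curve_length (m : M -> 'M[R]_n) (g : R -> M) : \bar R :=
  (\int[lebesgue_measure]_(t in `[0%R, 1%R]) (tnorm m (g t) (velocity g t))%:E)%E.

End tangent_vectors.

(* [mdist_riemannian] says that the distance of the metric space [M] is the
   Riemannian distance; as [mdist] is real-valued, [M] is then connected. *)
Record riemannianManifold (R : realType) (n : nat) (M : metricType R) := RiemannianManifold {
  atlas :> smoothAtlas R n M;
  gram : M -> 'M[R]_n;
  gram_sym : forall p, (gram p)^T = gram p;
  gram_posdef : forall p (v : 'rV[R]_n), v != 0 -> 0 < inner gram p v v;
  gram_smooth : forall c : chart_index atlas,
    smooth_on (chart c @` chart_dom c) (metric_coef gram c);
  mdist_riemannian : forall p q : M,
    (mdist p q)%:E = ereal_inf [set curve_length atlas gram g | g in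
      [set g : R -> M | [/\ C1_curve atlas g, g 0 = p & g 1 = q]]]
}.

Section riemannian_geometry.
Context {R : realType} {n : nat} {M : metricType R} (G : riemannianManifold n M).

Local Notation tvec := 'rV[R]_n.

(* The coefficient of index [k] of the covariant derivative of the [j]-th
   coordinate field along the [i]-th one, for the Levi-Civita connection. *)
Definition christoffel (c : chart_index G) (i j k : 'I_n) (x : tvec) : R :=
  let gc := metric_coef (gram G) c in
  let d a b l := 'D_(delta_mx 0 a : tvec) (fun y => gc y b l) x in
  2^-1 * \sum_(l < n) invmx (gc x) k l * (d i j l + d j i l - d l i j).

Definition connection_form (c : chart_index G) (x u w : tvec) : tvec :=
  \row_k \sum_(i < n) \sum_(j < n) christoffel c i j k x * u 0 i * w 0 j.

Definition parallel_field (g : R -> M) (V : R -> tvec) : Prop :=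
  forall t (c : chart_index G), chart_dom c (g t) ->
    let Vc s := tangent_coord (chart_at G (g s)) c (g s) (V s) in
    derivable Vc t 1 /\
    derive1 Vc t = - connection_form c (chart c (g t)) (derive1 (chart c \o g) t) (Vc t).

(* Transport along [g] from the tangent space at [g s] to the one at [g t]. *)
Definition parallel_transport (g : R -> M) (s t : R) (v : tvec) : tvec :=
  xget 0 [set w | exists V, [/\ parallel_field g V, V s = v & V t = w]].

(* Geodesics are parametrized by the whole real line: by completeness every
   geodesic segment is the restriction of one of these. *)
Definition geodesic (g : R -> M) : Prop :=
  C1_curve G g /\ parallel_field g (velocity G g).

Definition minimizing_geodesic (p q : M) (g : R -> M) : Prop :=
  [/\ geodesic g, g 0 = p, g 1 = q & curve_length G (gram G) g = (mdist p q)%:E].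

Definition geodesically_complete : Prop :=
  forall p (v : tvec), exists g, [/\ geodesic g, g 0 = p & velocity G g 0 = v].

Definition rexp (p : M) (v : tvec) : M :=
  xget p [set q | exists g, [/\ geodesic g, g 0 = p, velocity G g 0 = v & g 1 = q]].

Definition injectivity_radius_at (p : M) : \bar R :=
  ereal_sup [set r%:E | r in [set r : R | 0 < r /\
    diffeo_onto_open G [set v | tnorm (gram G) p v < r] (rexp p)]].

Definition injectivity_radius : \bar R :=
  ereal_inf [set injectivity_radius_at p | p in [set: M]].

Definition normal_domain (p : M) (U : set tvec) : Prop :=
  [/\ diffeo_onto_open G U (rexp p),
      (forall v s, U v -> 0 <= s <= 1 -> U (s *: v))
    & forall v, U v -> mdist p (rexp p v) = tnorm (gram G) p v].

Definition is_log (p q : M) (v : tvec) : Prop :=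
  exists U, [/\ normal_domain p U, U v & rexp p v = q].

(* The union of the normal domains at [p] is the region enclosed by the tangent
   cut locus, so [rlog p] is the usual logarithm, defined off the cut locus of
   [p] (in particular on the open ball of radius [injectivity_radius] about
   [p]); it takes the value 0 by convention on the cut locus. *)
Definition rlog (p q : M) : tvec :=
  xget 0 [set v | is_log p q v /\ forall w, is_log p q w -> w = v].

(* The [l]-th component of R(e_i, e_j) e_k, for the convention
   R(u, v) = [nabla_u, nabla_v] - nabla_[u, v]. *)
Definition curvature_coef (c : chart_index G) (i j k l : 'I_n) (x : tvec) : R :=
  'D_(delta_mx 0 i : tvec) (christoffel c j k l) x
  - 'D_(delta_mx 0 j : tvec) (christoffel c i k l) x
  + \sum_(m < n) (christoffel c i m l x * christoffel c j k m x
                  - christoffel c j m l x * christoffel c i k m x).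

Definition riemann_curvature (p : M) (u v w : tvec) : tvec :=
  let c := chart_at G p in
  \row_l \sum_(i < n) \sum_(j < n) \sum_(k < n)
    curvature_coef c i j k l (chart c p) * u 0 i * v 0 j * w 0 k.

Definition sectional_curvature (p : M) (u v : tvec) : R :=
  let ip := inner (gram G) p in
  ip (riemann_curvature p u v v) u / (ip u u * ip v v - ip u v ^+ 2).

Definition curvature_bounded_above (kappa : R) : Prop :=
  forall p (u v : tvec), row_free (col_mx u v) -> sectional_curvature p u v <= kappa.

(* r <= min(inj M, pi / sqrt kappa) / 2, required only when kappa > 0 *)
Definition admissible_radius (kappa r : R) : Prop :=
  0 < kappa ->
  (r%:E <= (2^-1)%:E * Order.min injectivity_radius (pi / Num.sqrt kappa)%:E)%E.

(* the rows of [e] are an orthonormal basis of the tangent space at [p] *)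
Definition orthonormal_basis (p : M) (e : 'M[R]_n) : Prop :=
  e *m gram G p *m e^T = 1%:M.

Definition onb_coord (p : M) (e : 'M[R]_n) (v : tvec) : tvec :=
  \row_i inner (gram G) p v (row i e).

End riemannian_geometry.

Section riemannian_correlation.
Context {R : realType} {n : nat} {M : metricType R} (G : riemannianManifold n M)
        {d : measure_display} {T : measurableType d} (P : probability T R).

Definition random_element (Z : T -> M) : Prop :=
  forall B : set M, <<s open>> B -> measurable (Z @^-1` B).

Definition is_frechet_mean (Z : T -> M) (m : M) : Prop :=
  forall x : M, ('E_P[fun w => (mdist m (Z w) ^+ 2)%R] <= 'E_P[fun w => (mdist x (Z w) ^+ 2)%R])%E.

Definition unique_frechet_mean (Z : T -> M) (m : M) : Prop :=
  is_frechet_mean Z m /\ forall m', is_frechet_mean Z m' -> m' = m.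

Definition in_ball (Z : T -> M) (p0 : M) (r : R) : Prop :=
  {ae P, forall w, mdist p0 (Z w) < r}.

(* E[U V^T] for random tangent vectors [U], [V] at [p], written in coordinates
   of the orthonormal basis [e] of the tangent space at [p]. *)
Definition expected_outer (p : M) (e : 'M[R]_n) (U V : T -> 'rV[R]_n) : 'M[R]_n :=
  \matrix_(i, j)
    fine 'E_P[fun w => (onb_coord G p e (U w) 0 i * onb_coord G p e (V w) 0 j)%R]%E.

(* In what follows [alpha] is the minimizing geodesic from [mu] (time 0) to [nu]
   (time 1), the point p of the geodesic is [alpha t], and [E] chooses an
   orthonormal basis of each tangent space. *)
Definition Sigma_XY (E : M -> 'M[R]_n) (X Y : T -> M) (mu nu : M)
    (alpha : R -> M) (t : R) : 'M[R]_n :=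
  expected_outer (alpha t) (E (alpha t))
    (fun w => parallel_transport G alpha 0 t (rlog G mu (X w)))
    (fun w => parallel_transport G alpha 1 t (rlog G nu (Y w))).

Definition Cov_XY (E : M -> 'M[R]_n) (X Y : T -> M) (mu nu : M)
    (alpha : R -> M) (t : R) : R :=
  \tr (Sigma_XY E X Y mu nu alpha t).

Definition Cov_ZZ (E : M -> 'M[R]_n) (Z : T -> M) (m : M) : R :=
  \tr (expected_outer m (E m) (fun w => rlog G m (Z w)) (fun w => rlog G m (Z w))).

Definition riemannian_correlation (E : M -> 'M[R]_n) (X Y : T -> M) (mu nu : M)
    (alpha : R -> M) (t : R) : R :=
  Cov_XY E X Y mu nu alpha t /
  (Num.sqrt (Cov_ZZ E X mu) * Num.sqrt (Cov_ZZ E Y nu)).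

End riemannian_correlation.

(* Main.v *)
(* Parallel fields along a curve have constant norm, because the Christoffel
   symbols make the metric parallel; hence parallel transport does not increase
   norms.  In orthonormal coordinates Cov_{X,Y}(p) is thus the expectation of
   the inner product of two transported vectors, and Cauchy-Schwarz bounds it by
   the product of the square roots of the variances at mu and nu.  Integrability
   follows from compactness (|log_mu q| <= d(mu, q)) and from the measurability
   of the logarithm, which is the inverse of an open map off an open set of
   points with several logarithms. *)
Require Import Defs.
From HB Require Import structures.
From mathcomp Require Import all_boot all_order all_algebra.
From mathcomp Require Import all_classical all_reals all_analysis.
From mathcomp Require Import measurable_realfun ring lra.

Set Implicit Arguments.
Unset Strict Implicit.
Unset Printing Implicit Defensive.

Import Order.TTheory GRing.Theory Num.Theory.
Import numFieldNormedType.Exports.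

Local Open Scope classical_set_scope.
Local Open Scope ring_scope.

(** * Changes of chart and tangent coordinates *)

Section charts.
Context {R : realType} {n : nat} {M : topologicalType} (A : smoothAtlas R n M).
Implicit Types (c : chart_index A) (p : M).

Lemma transition_differentiable c c' p : chart_dom c p -> chart_dom c' p ->
  differentiable (chart c' \o chart_inv c) (chart c p).
Proof.
by move=> cp c'p; apply: (chart_smooth c c' 1).1; exists p.
Qed.

Lemma transition_inverse_near c c' p : chart_dom c p -> chart_dom c' p ->
  \forall x \near chart c p,
    ((chart c \o chart_inv c') \o (chart c' \o chart_inv c)) x = x.
Proof.
move=> cp c'p.
have imc : (chart c @` chart_dom c) (chart c p) by exists p.
have near1 : \forall x \near chart c p, (chart c @` chart_dom c) x.
  by apply: open_nbhs_nbhs; split=> //; exact: chart_image_open.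
have near2 : \forall x \near chart c p, chart_dom c' (chart_inv c x).
  apply: (chart_inv_continuous imc); rewrite chartK//.
  by apply: open_nbhs_nbhs; split=> //; exact: chart_dom_open.
by apply: filterS2 near1 near2 => x [q cq <-] /=; rewrite chartK// => /chartK ->.
Qed.

(** The two transition maps compose to the identity near [chart c p], so by the chain rule their
    differentials are inverse to each other. *)
Lemma tangent_coordK c c' p v : chart_dom c p -> chart_dom c' p ->
  tangent_coord c' c p (tangent_coord c c' p v) = v.
Proof.
move=> cp c'p; have d1 := transition_differentiable cp c'p.
have ee : (chart c' \o chart_inv c) (chart c p) = chart c' p.
  by rewrite /comp chartK.
have d2 : differentiable (chart c \o chart_inv c')
    ((chart c' \o chart_inv c) (chart c p)).
  by rewrite ee; exact: transition_differentiable.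
transitivity ('d ((chart c \o chart_inv c') \o (chart c' \o chart_inv c))
    (chart c p) v).
  by rewrite (diff_comp d1 d2) /tangent_coord -ee.
rewrite -(deriveE v (differentiable_comp d1 d2)).
by rewrite (near_eq_derive v (transition_inverse_near cp c'p)) derive_id.
Qed.

End charts.

(** * The metric and its Christoffel symbols in a chart *)

Section metric.
Context {R : realType} {n : nat} {M : metricType R} (G : riemannianManifold n M).
Implicit Types (c : chart_index G) (p : M) (u v w : 'rV[R]_n).

Lemma innerC p u v : inner (gram G) p u v = inner (gram G) p v u.
Proof.
rewrite /inner -[RHS](mxE (trmx_key) (fun i j => _ j i)) -/(trmx _).
by rewrite !trmx_mul gram_sym trmxK mulmxA.
Qed.

Lemma inner_ge0 p v : 0 <= inner (gram G) p v v.
Proof.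
have [->|/(gram_posdef G p)/ltW//] := eqVneq v 0.
by rewrite /inner !mul0mx mxE.
Qed.

Lemma inner_sum p (I J : finType) (a : I -> R) (b : J -> R)
    (u : I -> 'rV[R]_n) (v : J -> 'rV[R]_n) :
  inner (gram G) p (\sum_i a i *: u i) (\sum_j b j *: v j) =
  \sum_i \sum_j a i * b j * inner (gram G) p (u i) (v j).
Proof.
rewrite /inner !mulmx_suml summxE; apply: eq_bigr => i _.
rewrite raddf_sum/= mulmx_sumr summxE; apply: eq_bigr => j _.
by rewrite linearZ/= -!scalemxAl -scalemxAr scalerA mxE.
Qed.

Lemma inner_tangent_coord c p u v : chart_dom c p ->
  inner (gram G) p (tangent_coord c (chart_at G p) p u)
                   (tangent_coord c (chart_at G p) p v) =
  (u *m metric_coef (gram G) c (chart c p) *m v^T) 0 0.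
Proof.
move=> cp; rewrite [in LHS](row_sum_delta u) [in LHS](row_sum_delta v).
rewrite /tangent_coord !linear_sum.
under eq_bigr do rewrite linearZ; under [X in inner _ _ _ X]eq_bigr do rewrite linearZ.
rewrite inner_sum exchange_big !mxE/=; apply: eq_bigr => j _.
rewrite !mxE mulr_suml; apply: eq_bigr => i _.
by rewrite !mxE /= /tangent_coord !chartK//; ring.
Qed.

Lemma inner_in_chart c p u v : chart_dom c p ->
  inner (gram G) p u v =
  (tangent_coord (chart_at G p) c p u *m metric_coef (gram G) c (chart c p) *m
   (tangent_coord (chart_at G p) c p v)^T) 0 0.
Proof.
by move=> cp; rewrite -inner_tangent_coord// !tangent_coordK//; exact: chart_atP.
Qed.

Lemma metric_coef_sym c x i j :
  metric_coef (gram G) c x i j = metric_coef (gram G) c x j i.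
Proof. by rewrite !mxE innerC. Qed.

(** A row [v] of the kernel represents a tangent vector of norm zero; positive definiteness makes
    that vector 0, and changing charts back gives [v = 0]. *)
Lemma metric_coef_unit c p : chart_dom c p ->
  metric_coef (gram G) c (chart c p) \in unitmx.
Proof.
move=> cp; rewrite -row_free_unit -kermx_eq0; apply/eqP/row_matrixP => i.
rewrite row0; set v := row i _.
have vg : v *m metric_coef (gram G) c (chart c p) = 0.
  by rewrite -row_mul mulmx_ker row0.
have := inner_tangent_coord v v cp; rewrite vg mul0mx [RHS]mxE => iv0.
have [tv0|/(gram_posdef G p)] :=
  eqVneq (tangent_coord c (chart_at G p) p v) 0; last by rewrite iv0 ltxx.
by rewrite -(tangent_coordK v cp (chart_atP G p)) tv0 /tangent_coord linear0.
Qed.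

(** Lowering the upper index cancels the inverse metric and leaves the Christoffel symbols of the
    first kind. *)
Lemma christoffel_lower c p i j m : chart_dom c p ->
  let gc := metric_coef (gram G) c in
  let d a b l := 'D_(delta_mx 0 a : 'rV[R]_n) (fun y => gc y b l) (chart c p) in
  \sum_k gc (chart c p) m k * christoffel c i j k (chart c p) =
  2^-1 * (d i j m + d j i m - d m i j).
Proof.
move=> cp gc d.
transitivity (2^-1 * \sum_l (gc (chart c p) *m invmx (gc (chart c p))) m l *
    (d i j l + d j i l - d l i j)).
  rewrite mulr_sumr; under [RHS]eq_bigr do rewrite mxE mulr_suml mulr_sumr.
  rewrite exchange_big/=; apply: eq_bigr => k _.
  rewrite /christoffel -/gc mulr_sumr mulr_sumr; apply: eq_bigr => l _.
  by rewrite -/(d i j l) -/(d j i l) -/(d l i j); ring.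
congr (_ * _); rewrite mulmxV ?metric_coef_unit//.
rewrite (bigD1 m)//= mxE eqxx mul1r big1 ?addr0// => l lm.
by rewrite mxE eq_sym (negbTE lm) mul0r.
Qed.

(* Nabla g = 0 in the chart [c]. *)
Lemma metric_compatible c p (u w : 'rV[R]_n) : chart_dom c p ->
  let gc := metric_coef (gram G) c in
  \sum_m w 0 m * (\sum_k gc (chart c p) m k * connection_form c (chart c p) u w 0 k) =
  2^-1 * \sum_m \sum_j w 0 m * w 0 j *
    \sum_i u 0 i * 'D_(delta_mx 0 i : 'rV[R]_n) (fun y => gc y m j) (chart c p).
Proof.
move=> cp gc.
pose d a b l := 'D_(delta_mx 0 a : 'rV[R]_n) (fun y => gc y b l) (chart c p).
have dC a b l : d a b l = d a l b.
  rewrite /d (_ : (fun y => gc y b l) = fun y => gc y l b)//.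
  by apply/funext => y; exact: metric_coef_sym.
have E m : \sum_k gc (chart c p) m k * connection_form c (chart c p) u w 0 k =
    \sum_i \sum_j u 0 i * w 0 j * (2^-1 * (d i j m + d j i m - d m i j)).
  under eq_bigr do rewrite [connection_form _ _ _ _ _ _]mxE mulr_sumr.
  rewrite exchange_big/=; apply: eq_bigr => i _.
  under eq_bigr do rewrite mulr_sumr.
  rewrite exchange_big/=; apply: eq_bigr => j _.
  rewrite -christoffel_lower// mulr_sumr; apply: eq_bigr => k _.
  by rewrite -/gc; ring.
under eq_bigr do rewrite E.
(* Since [w] occurs twice, exchanging [m] and [j] identifies two of the three derivative terms;
   having opposite signs, they cancel. *)
pose S := \sum_m \sum_j \sum_i w 0 m * w 0 j * u 0 i * d m i j.
have S' : \sum_m \sum_j \sum_i w 0 m * w 0 j * u 0 i * d j i m = S.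
  rewrite exchange_big; apply: eq_bigr => j _; apply: eq_bigr => m _.
  by apply: eq_bigr => i _; ring.
transitivity (2^-1 * (\sum_m \sum_j \sum_i w 0 m * w 0 j * u 0 i * d i m j +
    \sum_m \sum_j \sum_i w 0 m * w 0 j * u 0 i * d j i m - S)); last first.
  rewrite S' addrK; congr (_ * _); apply: eq_bigr => m _; apply: eq_bigr => j _.
  by rewrite mulr_sumr; apply: eq_bigr => i _; rewrite -/(d i m j); ring.
rewrite -big_split -sumrB mulr_sumr; apply: eq_bigr => m _ /=.
rewrite -big_split -sumrB exchange_big/= !mulr_sumr; apply: eq_bigr => j _ /=.
rewrite -big_split -sumrB/= !mulr_sumr; apply: eq_bigr => i _ /=.
by rewrite (dC i j m); ring.
Qed.

End metric.

(** A matrix [B] of maximal rank with row space inside [S] already spans [S]: adjoining a vector of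
    [S] cannot raise the rank, so that vector lies in the row space. *)
Lemma linear_set_row_space (F : fieldType) (n : nat) (S : set 'rV[F]_n) :
  S 0 -> (forall a u v, S u -> S v -> S (a *: u + v)) ->
  exists B : 'M[F]_n, forall v, S v <-> (v <= B)%MS.
Proof.
move=> S0 Slin.
pose Q k := `[< exists2 B : 'M[F]_n, \rank B = k & forall v, (v <= B)%MS -> S v >].
have Q0 : exists k, Q k.
  exists 0%N; apply/asboolP; exists 0; first exact: mxrank0.
  by move=> v; rewrite submx0 => /eqP ->.
have Qn k : Q k -> (k <= n)%N by move=> /asboolP[B <- _]; exact: rank_leq_row.
case: (ex_maxnP Q0 Qn) => _ /asboolP[B <- BS] Bmax.
exists B => v; split=> [Sv|/BS//].
have /Bmax rB : Q (\rank (B + v)%MS).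
  apply/asboolP; exists (B + v)%MS => // w /sub_addsmxP[[a b] ->] /=.
  rewrite addrC [b]mx11_scalar mul_scalar_mx; apply: Slin => //.
  by apply: BS; exact: submxMl.
have : (B + v <= B)%MS by rewrite -(geq_leqif (mxrank_leqif_sup (addsmxSl B v))).
by rewrite addsmx_sub => /andP[].
Qed.

(** * Parallel fields and parallel transport *)

Section parallel.
Context {R : realType} {n : nat} {M : metricType R} (G : riemannianManifold n M).
Implicit Types (c : chart_index G) (p : M) (g : R -> M) (V : R -> 'rV[R]_n).

Lemma is_derive_coord (h : R -> 'rV[R]_n) t k : derivable h t 1 ->
  is_derive t 1 (fun s => h s 0 k) (derive1 h t 0 k).
Proof.
move=> dh; apply: DeriveDef; first exact: (derivable_mxP h t 1).1.
by rewrite derive1E derive_mx// mxE.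
Qed.

Lemma is_derive_along (f : 'rV[R]_n -> R) (h : R -> 'rV[R]_n) t :
  differentiable f (h t) -> derivable h t 1 ->
  is_derive t 1 (f \o h)
    (\sum_i derive1 h t 0 i * 'D_(delta_mx 0 i : 'rV[R]_n) f (h t)).
Proof.
move=> df dh; have dh' : differentiable h t by exact/derivable1_diffP.
have dfh := differentiable_comp dh' df.
apply: DeriveDef; first exact: diff_derivable.
rewrite (deriveE _ dfh) (diff_comp dh' df) /comp -(deriveE _ dh') -derive1E.
rewrite [X in 'd f _ X]row_sum_delta linear_sum; apply: eq_bigr => i _.
by rewrite linearZ (deriveE _ df).
Qed.

Lemma metric_coef_differentiable c p m j : chart_dom c p ->
  differentiable (fun y => metric_coef (gram G) c y m j) (chart c p).
Proof.
move=> cp; apply: (differentiable_comp (f := metric_coef (gram G) c)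
  (g := fun N : 'M[R]_n => N m j)); last exact: differentiable_coord.
by apply: (gram_smooth c 1).1; exists p.
Qed.

(** The preferred chart changes along [g]; differentiating the inner product requires an expression
    in one fixed chart, valid near [t]. *)
Lemma inner_along_near g V c t : continuous g -> chart_dom c (g t) ->
  let Vc s := tangent_coord (chart_at G (g s)) c (g s) (V s) in
  \forall s \near t,
    (\sum_m \sum_j ((fun s => Vc s 0 m) * (fun s => Vc s 0 j) *
      ((fun y => metric_coef (gram G) c y m j) \o (chart c \o g))) : R -> R) s =
    inner (gram G) (g s) (V s) (V s).
Proof.
move=> cg cgt Vc; have : \forall s \near t, chart_dom c (g s).
  by apply: cg; apply: open_nbhs_nbhs; split=> //; exact: chart_dom_open.
apply: filterS => s cgs; rewrite (inner_in_chart _ _ cgs) -/(Vc s) fct_sumE.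
under eq_bigr do rewrite fct_sumE.
rewrite exchange_big mxE/=; apply: eq_bigr => j _.
rewrite mxE mulr_suml; apply: eq_bigr => m _.
by rewrite [_^T _ _]mxE/= !fctE; ring.
Qed.

(** The derivative vanishes at each time: by the product rule it is a derivative of the metric minus
    two connection terms, and these cancel by [metric_compatible]. *)
Lemma parallel_field_inner g V s t : C1_curve G g -> parallel_field G g V ->
  inner (gram G) (g s) (V s) (V s) = inner (gram G) (g t) (V t) (V t).
Proof.
move=> [cg C1g] pV.
apply: (is_derive_0_is_cst (f := fun s => inner (gram G) (g s) (V s) (V s))).
move=> {s}{}t; pose c := chart_at G (g t).
have cgt : chart_dom c (g t) := chart_atP G (g t).
apply: near_eq_is_derive (inner_along_near V cg cgt) _.
pose Vc s := tangent_coord (chart_at G (g s)) c (g s) (V s).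
set gc := metric_coef (gram G) c.
have [dx _] := C1g t c cgt; have [dV eV] := pV t c cgt; rewrite -/Vc in dV eV.
set w := connection_form _ _ _ _ in eV; set x' := derive1 (chart c \o g) t in w eV.
pose dg m j := \sum_i x' 0 i * 'D_(delta_mx 0 i : 'rV[R]_n) (fun y => gc y m j) (chart c (g t)).
have dVc k : is_derive t 1 (fun s => Vc s 0 k) (- w 0 k).
  by have := is_derive_coord k dV; rewrite eV mxE.
have dgc m j : is_derive t 1 ((fun y => gc y m j) \o (chart c \o g)) (dg m j).
  exact: (is_derive_along (metric_coef_differentiable m j cgt) dx).
(* The [(m, j)] term of the derivative, with the derivative of [Vc] already replaced by [- w]. *)
pose D m j := Vc t 0 m * Vc t 0 j * dg m j
  - gc (chart c (g t)) m j * (Vc t 0 m * w 0 j + Vc t 0 j * w 0 m).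
suff D0 : \sum_m \sum_j D m j = 0.
  rewrite -D0; apply: is_derive_sum => m; apply: is_derive_sum => j.
  have := is_deriveM (is_deriveM (dVc m) (dVc j)) (dgc m j).
  set z := (X in is_derive _ _ _ X -> _); set z' := D m j.
  suff -> : z = z' by [].
  by rewrite /z /z' /D /= fctE /GRing.scale/=; ring.
(* [S] gathers the derivatives of the metric and [W] is one of two equal connection sums, so the
   total is [S - 2 W]; compatibility gives [W = S / 2]. *)
pose S := \sum_m \sum_j Vc t 0 m * Vc t 0 j * dg m j.
pose W := \sum_m \sum_j Vc t 0 m * (gc (chart c (g t)) m j * w 0 j).
have WS : W = 2^-1 * S.
  rewrite -[RHS](metric_compatible x' (Vc t) cgt).
  by apply: eq_bigr => m _; rewrite mulr_sumr.
have W' : \sum_m \sum_j Vc t 0 j * (gc (chart c (g t)) m j * w 0 m) = W.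
  rewrite exchange_big; apply: eq_bigr => j _; apply: eq_bigr => m _.
  by rewrite /gc metric_coef_sym.
transitivity (S - (W + W)); last by rewrite WS; field.
rewrite -{2}W' /S /W -big_split -sumrB; apply: eq_bigr => m _ /=.
rewrite -big_split -sumrB; apply: eq_bigr => j _ /=.
by rewrite /D; ring.
Qed.

Lemma tangent_coord_linear c c' p (a : R) u v :
  tangent_coord c c' p (a *: u + v) =
  a *: tangent_coord c c' p u + tangent_coord c c' p v.
Proof. by rewrite /tangent_coord linearP. Qed.

Lemma connection_form_linear c x u (a : R) v w :
  connection_form c x u (a *: v + w) =
  a *: connection_form c x u v + connection_form c x u w.
Proof.
apply/rowP => k; rewrite !mxE mulr_sumr -big_split; apply: eq_bigr => i _ /=.
rewrite mulr_sumr -big_split; apply: eq_bigr => j _ /=.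
by rewrite !mxE; ring.
Qed.

Lemma parallel_field_linear g V W (a : R) :
  parallel_field G g V -> parallel_field G g W ->
  parallel_field G g (fun t => a *: V t + W t).
Proof.
move=> pV pW t c cgt; have [dV eV] := pV t c cgt; have [dW eW] := pW t c cgt.
set Vc := fun s => tangent_coord _ _ _ (V s) in dV eV.
set Wc := fun s => tangent_coord _ _ _ (W s) in dW eW.
have -> : (fun s => tangent_coord (chart_at G (g s)) c (g s) (a *: V s + W s)) =
    (a *: Vc) + Wc.
  by apply/funext => s; rewrite tangent_coord_linear.
have da : derivable (a *: Vc) t 1 := @derivableZ _ _ _ Vc a t 1 dV.
split; first exact: (derivableD da dW).
rewrite derive1E (deriveD da dW) (deriveZ _ dV) -!derive1E eV eW.
rewrite -[(a *: Vc + Wc) t]/(a *: Vc t + Wc t).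
by rewrite connection_form_linear scalerN opprD.
Qed.

Lemma parallel_field0 g : parallel_field G g (fun=> 0).
Proof.
move=> t c cgt.
have -> : (fun s => tangent_coord (chart_at G (g s)) c (g s) 0) = cst 0.
  by apply/funext => s; rewrite /tangent_coord linear0.
split; first exact: derivable_cst.
rewrite derive1E derive_cst; apply/esym/eqP; rewrite oppr_eq0; apply/eqP.
apply/rowP => k; rewrite !mxE big1// => i _; rewrite big1// => j _.
by rewrite mxE mulr0.
Qed.

(** The difference of the fields is parallel, and its constant norm is zero at time [s]. *)
Lemma parallel_field_eq g V W s t : C1_curve G g ->
  parallel_field G g V -> parallel_field G g W -> V s = W s -> V t = W t.
Proof.
move=> C1g pV pW VWs; pose U r := -1 *: V r + W r.
have pU : parallel_field G g U := parallel_field_linear (-1) pV pW.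
have := parallel_field_inner s t C1g pU.
rewrite {1 2}/U VWs scaleN1r addNr {1}/inner !mul0mx mxE => iU0.
have [/eqP|/(gram_posdef G (g t))] := eqVneq (U t) 0; last by rewrite -iU0 ltxx.
by rewrite /U scaleN1r addrC subr_eq0 => /eqP.
Qed.

(** By uniqueness of parallel fields, the set from which [xget] chooses has a single element. *)
Lemma parallel_transportE g V s t : C1_curve G g -> parallel_field G g V ->
  parallel_transport G g s t (V s) = V t.
Proof.
move=> C1g pV; apply: xget_subset1; first by exists V.
move=> u w [U [pU Us Ut]] [W [pW Ws Wt]].
have UWs : U s = W s by rewrite Us Ws.
by rewrite -Ut -Wt; exact: (parallel_field_eq t C1g pU pW UWs).
Qed.

(** If no parallel field passes through [v], then [xget] returns its default 0. *)
Lemma parallel_transport_cases g s t v : C1_curve G g ->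
  (exists2 V, parallel_field G g V & V s = v) \/
  parallel_transport G g s t v = 0.
Proof.
move=> C1g; have [?|nex] := pselect (exists2 V, parallel_field G g V & V s = v).
  by left.
right; apply: xgetPN => w [V [pV Vs _]]; apply: nex; by exists V.
Qed.

(** Equality holds when [v] extends to a parallel field; the default 0 accounts for the inequality,
    whose direction is the one that the final bound uses. *)
Lemma parallel_transport_contracts g s t v : C1_curve G g ->
  inner (gram G) (g t) (parallel_transport G g s t v)
                       (parallel_transport G g s t v)
  <= inner (gram G) (g s) v v.
Proof.
move=> C1g; have [[V pV <-]|->] := parallel_transport_cases s t v C1g.
  by rewrite parallel_transportE// (parallel_field_inner s t C1g pV).
by rewrite {1}/inner !mul0mx mxE inner_ge0.
Qed.

(* Without appealing to the existence of parallel fields, the vectors that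
   extend to one form a linear subspace, the row space of [B]. *)
Lemma parallel_transport_matrix g s t : C1_curve G g ->
  exists B L : 'M[R]_n, forall v,
    parallel_transport G g s t v = if (v <= B)%MS then v *m L else 0.
Proof.
move=> C1g.
pose S v := exists2 V, parallel_field G g V & V s = v.
have S0 : S 0 by exists (fun=> 0) => //; exact: parallel_field0.
have Slin a u v : S u -> S v -> S (a *: u + v).
  move=> [U pU <-] [V pV <-]; exists (fun r => a *: U r + V r) => //.
  exact: parallel_field_linear.
have [B BS] := linear_set_row_space S0 Slin.
pose F v : 'rV[R]_n := parallel_transport G g s t v.
have Flin a u v : S u -> S v -> F (a *: u + v) = a *: F u + F v.
  move=> [U pU <-] [V pV <-]; rewrite /F !parallel_transportE//.
  by rewrite (parallel_transportE _ (V := fun r => a *: U r + V r))//; exact: parallel_field_linear.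
(* For [v] in the row space of [B], [v *m pinvmx B] lists coefficients of [v] on the rows of [B];
   these then combine the transported rows. *)
exists B, (pinvmx B *m \matrix_i F (row i B)) => v.
case: ifPn => [vB|/negP vB]; last first.
  have [Sv|//] := parallel_transport_cases s t v C1g.
  by case: vB; apply/BS.
rewrite mulmxA; set u := v *m pinvmx B.
rewrite -[in LHS](mulmxKpV vB) -/u !mulmx_sum_row -/(F _).
have F0 : F 0 = 0.
  rewrite -[in LHS](addr0 0) -[in X in F (X + _)](scaler0 _ (-1)) Flin//.
  by rewrite scaleN1r addNr.
(* Additivity of [F] is known only on [S], so the induction on the sum carries membership of the
   partial sums in [S] along. *)
suff [] : S (\sum_i u 0 i *: row i B) /\
    F (\sum_i u 0 i *: row i B) = \sum_i u 0 i *: row i (\matrix_i F (row i B)) by [].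
elim/big_rec2 : _ => // i _ w _ [Sw <-].
have Sr : S (row i B) by apply/BS; exact: row_sub.
by split; [exact: Slin|rewrite Flin// rowK].
Qed.

End parallel.

(** * Regularity and size of the logarithm *)

Section logarithm.
Context {R : realType} {n : nat} {M : metricType R} (G : riemannianManifold n M).
Implicit Types (c : chart_index G) (p q : M) (U O : set 'rV[R]_n).

(** The inverse [h], read in a chart, is continuous at [q]. Points near [q] therefore have the form
    [f u] with [u = h (f u)] in [O]. *)
Lemma diffeo_open_image U f O : diffeo_onto_open G U f -> open O ->
  open (f @` (U `&` O)).
Proof.
move=> [oU _ ofU _ [h hf hsmooth]] oO; rewrite openE => _ [v [Uv Ov] <-].
set q := f v; have cq : chart_dom (chart_at G q) q := chart_atP G q.
set c := chart_at G q in cq.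
have fUq : (f @` U) q by exists v.
have hc : {for chart c q, continuous (h \o chart_inv c)}.
  by apply: (hsmooth c 0); exists q.
have hcq : (h \o chart_inv c) (chart c q) = v by rewrite /= chartK// hf.
have near1 : \forall y \near q, chart_dom c y.
  by apply: open_nbhs_nbhs; split=> //; exact: chart_dom_open.
have near2 : \forall y \near q, (f @` U) y by apply: open_nbhs_nbhs.
have near3 : \forall x \near chart c q, O ((h \o chart_inv c) x).
  by apply: hc; rewrite hcq; apply: open_nbhs_nbhs.
have near4 : \forall y \near q, O ((h \o chart_inv c) (chart c y)).
  exact: (chart_continuous cq) near3.
rewrite /interior; near=> y.
have cy : chart_dom c y by near: y.
have [u Uu uy] : (f @` U) y by near: y.
have : O ((h \o chart_inv c) (chart c y)) by near: y.
by rewrite /= chartK// -uy hf// => Ou; exists u.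
Unshelve. all: by end_near. Qed.

(* Where [rlog p] is given by a unique logarithm it inverts an open map; the
   points with several logarithms form an open set, because two of them can
   be separated; elsewhere [rlog p] is 0. *)
Lemma rlog_preimage_open p O : open O ->
  exists A B N : set M, [/\ open A, open B, open N &
    rlog G p @^-1` O = (A `\` N) `|` [set q | O 0 /\ ~ (B `\` N) q]].
Proof.
move=> oO.
pose W O q := exists U v, [/\ normal_domain G p U, U v, O v & rexp G p v = q].
have oW O' : open O' -> open (W O').
  move=> oO'; rewrite (_ : W O' =
      \bigcup_(U in normal_domain G p) (rexp G p @` (U `&` O'))).
    by apply: bigcup_open => U [dU _ _]; exact: diffeo_open_image.
  rewrite eqEsubset; split=> q; first by move=> [U [v [? ? ? <-]]]; exists U => //; exists v.
  by move=> [U ? [v [? ?] <-]]; exists U, v.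
pose N q := exists v w, [/\ is_log G p q v, is_log G p q w & v <> w].
have oN : open N.
  rewrite openE => q [v [w [ [U [nU Uv vq]] [U' [nU' U'w wq]] vw]]].
  have := @norm_hausdorff _ 'rV[R]_n; rewrite open_hausdorff.
  move=> /(_ v w (introN eqP vw)) [] [B1 B2] /=.
  rewrite !inE => -[B1v B2w] [oB1 oB2 B12].
  (* Every point near [q] has a logarithm in [B1] and another in [B2]; these sets are disjoint, so
     the two logarithms differ. *)
  rewrite /interior; near=> y.
  have [v' [Uv' B1v'] v'y] : (rexp G p @` (U `&` B1)) y.
    near: y; apply: open_nbhs_nbhs; split; last by exists v.
    by apply: diffeo_open_image => //; case: nU.
  have [w' [U'w' B2w'] w'y] : (rexp G p @` (U' `&` B2)) y.
    near: y; apply: open_nbhs_nbhs; split; last by exists w.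
    by apply: diffeo_open_image => //; case: nU'.
  exists v', w'; split; [by exists U|by exists U'|move=> vw'].
  by rewrite -[False]/(set0 v') -B12; split=> //; rewrite vw'.
(* [W O] holds the points with a logarithm in [O], and [W setT] those with any logarithm; off
   [W setT], and on [N], [rlog] takes its default 0. *)
exists (W O), (W setT), N; split=> //; [exact: oW|by apply: oW; exact: openT|].
have logE q v : is_log G p q v -> ~ N q -> rlog G p q = v.
  move=> qv nq; have uq w : is_log G p q w -> w = v.
    by move=> qw; apply: contrapT => wv; apply: nq; exists w, v.
  apply: xget_subset1; first by split.
  by move=> x y [/uq -> _] [/uq -> _].
have log0 q : ~ (W setT `\` N) q -> rlog G p q = 0.
  move=> nq; apply: xgetPN => v [[U [nU Uv vq]] uv]; apply: nq; split.
    by exists U, v.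
  by move=> [w [w' [/uv -> /uv ->]]].
rewrite eqEsubset; split=> q /=.
  have [[[U [v [nU Uv _ vq]]] nq]|nq] := pselect ((W setT `\` N) q).
    have qv : is_log G p q v by exists U.
    by rewrite (logE q v)// => Ov; left; split=> //; exists U, v.
  by rewrite (log0 q nq); right.
move=> [[[U [v [nU Uv Ov vq]]] nq]|[zO /log0 ->]//].
by rewrite (logE q v)//; exists U.
Unshelve. all: by end_near. Qed.

(** On a normal domain the distance from [p] equals the norm, which gives equality wherever a unique
    logarithm exists; for the default 0 the bound is trivial. *)
Lemma inner_rlog_le p q :
  inner (gram G) p (rlog G p q) (rlog G p q) <= mdist p q ^+ 2.
Proof.
rewrite /rlog; case: xgetP => [v _ [[U [[_ _ dU] Uv <-]] _]|_].
  by rewrite dU// sqr_sqrtr// inner_ge0.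
by rewrite /inner !mul0mx mxE sqr_ge0.
Qed.

End logarithm.

Lemma mdist_continuous {R : realType} {M : metricType R} (p : M) :
  continuous (mdist p : M -> R).
Proof.
move=> q; apply/cvgrPdist_lt => e e0.
have : nbhs q (ball q e) by exact: nbhsx_ballx.
apply: filterS => r; rewrite ballEmdist/= => qr.
have := metric_triangle p q r; have := metric_triangle p r q.
rewrite (metric_sym r q) => h1 h2; apply: le_lt_trans qr.
by rewrite ler_norml; apply/andP; split; lra.
Qed.

Lemma compact_mdist_bounded {R : realType} {M : metricType R} (p : M) :
  compact [set: M] -> exists C : R, forall q, mdist p q <= C.
Proof.
move=> cM; have cdM : compact (mdist p @` [set: M]).
  by apply: continuous_compact => //; exact/continuous_subspaceT/mdist_continuous.
have [C [_ CP]] := compact_bounded cdM.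
(* [compact_bounded] yields a bound by every number strictly above [C], hence the added 1. *)
exists (C + 1) => q; apply: le_trans (ler_norm _) _.
by apply: CP; [rewrite ltrDl|exists q].
Qed.

(** * Measurability of logarithms and transported vectors *)

Section random_vectors.
Context {R : realType} {d : measure_display} {T : measurableType d}.

Definition measurable_vector {n : nat} (U : T -> 'rV[R]_n) : Prop :=
  forall i, measurable_fun setT (fun w => U w 0 i).

Lemma measurable_vector_open {n : nat} (U : T -> 'rV[R]_n) :
  (forall O : set 'rV[R]_n, open O -> measurable (U @^-1` O)) ->
  measurable_vector U.
Proof.
move=> mU i; apply: (measurability _ (RGenOpens.measurableE R)).
move=> _ [_ [a [b ->] <-]]; rewrite setTI.
apply: (mU ((fun v : 'rV[R]_n => v 0 i) @^-1` `]a, b[%classic)).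
by apply: open_comp; [move=> v _; exact: coord_continuous|exact: interval_open].
Qed.

Lemma measurable_vector_mulmx {m n : nat} (U : T -> 'rV[R]_m) (L : 'M[R]_(m, n)) :
  measurable_vector U -> measurable_vector (fun w => U w *m L).
Proof.
move=> mU i; have -> : (fun w => (U w *m L) 0 i) =
    fun w => \sum_j U w 0 j * L j i by apply/funext => w; rewrite mxE.
by apply: measurable_sum => j; exact: measurable_funM.
Qed.

(** A vector vanishes exactly when its sum of squares does, which reduces the test to a measurable
    real function. *)
Lemma measurable_vector_eq0 {n : nat} (U : T -> 'rV[R]_n) :
  measurable_vector U -> measurable_fun setT (fun w => U w == 0).
Proof.
move=> mU; have -> : (fun w => U w == 0) =
    fun w => (\sum_i U w 0 i * U w 0 i == 0).
  apply/funext => w; apply/eqP/eqP => [->|/psumr_eq0P Uw0].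
    by apply: big1 => i _; rewrite mxE mul0r.
  apply/rowP => i; rewrite mxE; apply/eqP; rewrite -sqrf_eq0 expr2.
  by apply/eqP/Uw0 => // j _; rewrite -expr2 sqr_ge0.
apply: measurable_fun_eqr => //.
by apply: measurable_sum => i; exact: measurable_funM.
Qed.

Lemma measurable_parallel_transport {n : nat} {M : metricType R}
    (G : riemannianManifold n M) g s t (U : T -> 'rV[R]_n) :
  C1_curve G g -> measurable_vector U ->
  measurable_vector (fun w => parallel_transport G g s t (U w)).
Proof.
move=> C1g mU i; have [B [L BL]] := parallel_transport_matrix s t C1g.
(* Membership in the row space of [B] becomes the vanishing of a linear image, so transport is a
   measurable choice between a linear map and 0. *)
rewrite (_ : (fun w => _) = fun w =>
    if U w *m cokermx B == 0 then (U w *m L) 0 i else 0).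
  apply: measurable_fun_ifT => //; last exact: measurable_vector_mulmx.
  exact/measurable_vector_eq0/measurable_vector_mulmx.
by apply/funext => w; rewrite BL submxE; case: ifP => //; rewrite mxE.
Qed.

Lemma measurable_rlog {n : nat} {M : metricType R} (G : riemannianManifold n M)
    (p : M) (Z : T -> M) :
  random_element Z -> measurable_vector (fun w => rlog G p (Z w)).
Proof.
move=> mZ; apply: measurable_vector_open => O oO.
have [A [B [N [oA oB oN E]]]] := rlog_preimage_open G p oO.
have mZo D : open D -> measurable (Z @^-1` D).
  by move=> oD; apply: mZ; exact: sub_sigma_algebra.
rewrite -[_ @^-1` O]/(Z @^-1` (rlog G p @^-1` O)) E preimage_setU.
apply: measurableU; first exact: measurableD (mZo _ oA) (mZo _ oN).
(* The remaining piece comes from the default value of [rlog]: it is a complement if [O] contains 0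
   and empty otherwise. *)
have [zO|nzO] := pselect (O 0).
  rewrite (_ : Z @^-1` _ = ~` (Z @^-1` B `\` Z @^-1` N)).
    by apply: measurableC; exact: measurableD (mZo _ oB) (mZo _ oN).
  by rewrite eqEsubset; split=> w; [case|].
rewrite (_ : Z @^-1` _ = set0); first exact: measurable0.
by rewrite -subset0 => w [].
Qed.

End random_vectors.

(** * Coordinates in an orthonormal basis *)

Section orthonormal_coordinates.
Context {R : realType} {n : nat} {M : metricType R} (G : riemannianManifold n M).

Lemma onb_coordE p (e : 'M[R]_n) u : onb_coord G p e u = u *m (gram G p *m e^T).
Proof.
apply/rowP => i; rewrite mxE mulmxA /inner !mxE; apply: eq_bigr => j _.
by rewrite !mxE.
Qed.

(** Parseval's identity: a one-sided inverse of a square matrix is two-sided, so orthonormality also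
    gives [gram G p *m e^T *m e = 1]. *)
Lemma onb_coord_inner p (e : 'M[R]_n) u v : orthonormal_basis G p e ->
  \sum_i onb_coord G p e u 0 i * onb_coord G p e v 0 i = inner (gram G) p u v.
Proof.
rewrite /orthonormal_basis -mulmxA => /mulmx1C ge1.
transitivity ((onb_coord G p e u *m (onb_coord G p e v)^T) 0 0).
  by rewrite mxE; apply: eq_bigr => i _; rewrite [_^T _ _]mxE.
rewrite !onb_coordE !trmx_mul trmxK gram_sym -mulmxA.
by rewrite [X in u *m X]mulmxA [X in u *m (X *m _)]mulmxA -mulmxA ge1 mul1mx /inner mulmxA.
Qed.

End orthonormal_coordinates.

(** * Cauchy-Schwarz for bounded random vectors *)

Section covariance_inequality.
Context {R : realType} {d : measure_display} {T : measurableType d}.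
Context (P : probability T R).

Lemma Rintegral_sum (I : Type) (r : seq I) (f : I -> T -> R) :
  (forall i, P.-integrable setT (EFin \o f i)) ->
  \int[P]_w (\sum_(i <- r) f i w) = \sum_(i <- r) \int[P]_w f i w.
Proof.
move=> intf; rewrite /Rintegral.
under eq_integral do rewrite -sumEFin.
rewrite (integral_sum _ (f := fun i => EFin \o f i))//.
rewrite sum_fine// => i _; apply: integrable_fin_num; [exact: measurableT|exact: intf].
Qed.

(** A nonnegative polynomial of degree at most two has nonpositive discriminant; the case [K = 0] is
    included. *)
Lemma quadratic_discriminant_le (F H K : R) :
  (forall s, 0 <= F + s * (H *+ 2) + s ^+ 2 * K) -> H ^+ 2 <= F * K.
Proof.
move=> pos; have := @deg_le2_poly_ge0 R (Poly [:: F; H *+ 2; K]) (size_Poly _).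
rewrite !coef_Poly/= => disc.
suff : (H *+ 2) ^+ 2 - 4 * K * F <= 0 by rewrite -mulr_natl; lra.
apply: disc => s; rewrite !horner_cons hornerC; move: (pos s).
by rewrite (_ : F + _ + _ = ((0 * s + K) * s + H *+ 2) * s + F)//; ring.
Qed.

(** [C] bounds the squared norm at every sample point, so products of coordinates are integrable
    under a probability. *)
Definition bounded_vector {n : nat} (U : T -> 'rV[R]_n) (C : R) : Prop :=
  measurable_vector U /\ forall w, \sum_i U w 0 i ^+ 2 <= C.

Lemma integrable_coord_mul {n : nat} (U V : T -> 'rV[R]_n) C i :
  bounded_vector U C -> bounded_vector V C ->
  P.-integrable setT (EFin \o (fun w => U w 0 i * V w 0 i)).
Proof.
move=> [mU UC] [mV VC]; apply: measurable_bounded_integrable => //.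
- by apply: (le_lt_trans (probability_le1 P measurableT)); rewrite ltry.
- exact: measurable_funM.
exists C; split=> [|x Cx]; first exact: num_real.
move=> w _; apply: le_trans (ltW Cx).
have le1 (W : T -> 'rV[R]_n) : W w 0 i ^+ 2 <= \sum_j W w 0 j ^+ 2.
  by rewrite (bigD1 i)//= lerDl sumr_ge0// => j _; rewrite sqr_ge0.
have := le_trans (le1 U) (UC w); have := le_trans (le1 V) (VC w).
(* The squares of the sum and of the difference bound twice the absolute product by the sum of the
   two squares, at most [2 C]. *)
have := sqr_ge0 (U w 0 i + V w 0 i); have := sqr_ge0 (U w 0 i - V w 0 i).
by rewrite ler_norml => *; apply/andP; split; nra.
Qed.

Lemma sum_fine_expectation {n : nat} (U V : T -> 'rV[R]_n) C :
  bounded_vector U C -> bounded_vector V C ->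
  \sum_i fine 'E_P[fun w => (U w 0 i * V w 0 i)%R]%E =
  \int[P]_w \sum_i U w 0 i * V w 0 i.
Proof.
move=> bU bV; rewrite Rintegral_sum; last first.
  by move=> i; exact: integrable_coord_mul bU bV.
by apply: eq_bigr => i _; rewrite unlock.
Qed.

Lemma integrable_dot {n : nat} (U V : T -> 'rV[R]_n) C :
  bounded_vector U C -> bounded_vector V C ->
  P.-integrable setT (EFin \o (fun w => \sum_i U w 0 i * V w 0 i)).
Proof.
move=> bU bV; rewrite (_ : _ \o _ =
    fun w => (\sum_i (EFin \o (fun w => (U w 0 i * V w 0 i)%R)) w)%E).
  by apply: integrable_sum => // i _; exact: integrable_coord_mul bU bV.
by apply/funext => w; rewrite /= sumEFin.
Qed.

Lemma Rintegral_dot_cauchy_schwarz {n : nat} (U V : T -> 'rV[R]_n) C :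
  bounded_vector U C -> bounded_vector V C ->
  (\int[P]_w \sum_i U w 0 i * V w 0 i) ^+ 2 <=
  (\int[P]_w \sum_i U w 0 i * U w 0 i) * (\int[P]_w \sum_i V w 0 i * V w 0 i).
Proof.
move=> bU bV; apply: quadratic_discriminant_le => s.
have iUU := integrable_dot bU bU; have iUV := integrable_dot bU bV.
have iVV := integrable_dot bV bV.
set f := fun w => _ in iUU; set h := fun w => _ in iUV; set k := fun w => _ in iVV.
have iZ r q : P.-integrable setT (EFin \o q) ->
    P.-integrable setT (EFin \o (fun w => r * q w)) by exact: integrableZl.
(* The quadratic in [s] is the integral of the squared norm of [U + s V], hence nonnegative. *)
have -> : \int[P]_w f w + s * ((\int[P]_w h w) *+ 2) + s ^+ 2 * \int[P]_w k w =
    \int[P]_w (f w + (s *+ 2) * h w + s ^+ 2 * k w).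
  rewrite RintegralD ?RintegralD ?RintegralZl//; try exact: iZ.
    by rewrite mulrnAr mulrnAl.
  by apply: (integrableD _ iUU (iZ _ _ iUV)).
apply: Rintegral_ge0 => w _.
rewrite /f /h /k !mulr_sumr -!big_split/=; apply: sumr_ge0 => i _.
have := sqr_ge0 (U w 0 i + s * V w 0 i); rewrite -mulr_natl; lra.
Qed.

Lemma Rintegral_dot_le {n m : nat} (U : T -> 'rV[R]_n) (V : T -> 'rV[R]_m) C :
  bounded_vector U C -> bounded_vector V C ->
  (forall w, \sum_i U w 0 i * U w 0 i <= \sum_i V w 0 i * V w 0 i) ->
  \int[P]_w \sum_i U w 0 i * U w 0 i <= \int[P]_w \sum_i V w 0 i * V w 0 i.
Proof.
move=> bU bV UV; apply: le_Rintegral => //.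
  exact: (integrable_dot bU bU).
exact: (integrable_dot bV bV).
Qed.

End covariance_inequality.

(** * The bound on the correlation coefficient *)

Theorem proposition3p11 (R : realType) (n : nat) (M : metricType R)
  (G : riemannianManifold n M)
  (M_compact : compact [set: M]) (M_complete : geodesically_complete G)
  (d : measure_display) (T : measurableType d) (P : probability T R)
  (X Y : T -> M) (X_rv : random_element X) (Y_rv : random_element Y)
  (kappa : R) (kappaP : curvature_bounded_above G kappa)
  (pX pY : M) (rX rY : R)
  (rX_le : admissible_radius G kappa rX) (rY_le : admissible_radius G kappa rY)
  (X_ball : in_ball P X pX rX) (Y_ball : in_ball P Y pY rY)
  (mu nu : M)
  (muP : unique_frechet_mean P X mu) (nuP : unique_frechet_mean P Y nu)
  (munu_lt_inj : ((mdist mu nu)%:E < injectivity_radius G)%E)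
  (alpha : R -> M) (alphaP : minimizing_geodesic G mu nu alpha)
  (t : R) (t01 : 0 <= t <= 1)
  (E : M -> 'M[R]_n) (EP : forall q, orthonormal_basis G q (E q)) :
  -1 <= riemannian_correlation G P E X Y mu nu alpha t <= 1.
Proof.
have [[C1a _] a0 a1 _] := alphaP.
have [C1 C1P] := compact_mdist_bounded mu M_compact.
have [C2 C2P] := compact_mdist_bounded nu M_compact.
(* One constant serves both vectors, as the Cauchy-Schwarz lemma takes a common bound. *)
pose C := C1 ^+ 2 + C2 ^+ 2.
have dC1 q : mdist mu q ^+ 2 <= C.
  rewrite (le_trans (y := C1 ^+ 2)) ?lerDl ?sqr_ge0// lerXn2r ?nnegrE ?mdist_ge0//.
  by rewrite (le_trans _ (C1P q)) ?mdist_ge0.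
have dC2 q : mdist nu q ^+ 2 <= C.
  rewrite (le_trans (y := C2 ^+ 2)) ?lerDr ?sqr_ge0// lerXn2r ?nnegrE ?mdist_ge0//.
  by rewrite (le_trans _ (C2P q)) ?mdist_ge0.
pose co p (W : T -> 'rV[R]_n) w := onb_coord G p (E p) (W w).
have co_bounded p W : measurable_vector W ->
    (forall w, inner (gram G) p (W w) (W w) <= C) -> bounded_vector (co p W) C.
  move=> mW WC; split=> [|w].
    rewrite (_ : co p W = fun w => W w *m (gram G p *m (E p)^T)).
      exact: measurable_vector_mulmx.
    by apply/funext => w; rewrite /co onb_coordE.
  rewrite (le_trans _ (WC w))// -(onb_coord_inner _ _ (EP p)).
  by apply: ler_sum => i _; rewrite expr2.
pose x w := rlog G mu (X w); pose y w := rlog G nu (Y w).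
have mx : measurable_vector x := measurable_rlog G mu X_rv.
have my : measurable_vector y := measurable_rlog G nu Y_rv.
pose px w := parallel_transport G alpha 0 t (x w).
pose py w := parallel_transport G alpha 1 t (y w).
have px_le w : inner (gram G) (alpha t) (px w) (px w) <= inner (gram G) mu (x w) (x w).
  by rewrite -a0 parallel_transport_contracts.
have py_le w : inner (gram G) (alpha t) (py w) (py w) <= inner (gram G) nu (y w) (y w).
  by rewrite -a1 parallel_transport_contracts.
have xC w : inner (gram G) mu (x w) (x w) <= C := le_trans (inner_rlog_le G mu (X w)) (dC1 _).
have yC w : inner (gram G) nu (y w) (y w) <= C := le_trans (inner_rlog_le G nu (Y w)) (dC2 _).
have bx := co_bounded mu x mx xC.
have by_ := co_bounded nu y my yC.
have bpx := co_bounded (alpha t) px (measurable_parallel_transport 0 t C1a mx)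
  (fun w => le_trans (px_le w) (xC w)).
have bpy := co_bounded (alpha t) py (measurable_parallel_transport 1 t C1a my)
  (fun w => le_trans (py_le w) (yC w)).
(* The trace sums the diagonal expectations into the expectation of a dot product; this serves the
   covariance and both variances. *)
have covE p U V : bounded_vector (co p U) C -> bounded_vector (co p V) C ->
    \tr (expected_outer G P p (E p) U V) =
    \int[P]_w \sum_i co p U w 0 i * co p V w 0 i.
  move=> bU bV; rewrite -(sum_fine_expectation P bU bV).
  by apply: eq_bigr => i _; rewrite mxE.
rewrite /riemannian_correlation.
have -> : Cov_XY G P E X Y mu nu alpha t =
  \int[P]_w \sum_i co (alpha t) px w 0 i * co (alpha t) py w 0 i by exact: covE.
have -> : Cov_ZZ G P E X mu = \int[P]_w \sum_i co mu x w 0 i * co mu x w 0 i by exact: covE.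
have -> : Cov_ZZ G P E Y nu = \int[P]_w \sum_i co nu y w 0 i * co nu y w 0 i by exact: covE.
have lex := Rintegral_dot_le P bpx bx.
have ley := Rintegral_dot_le P bpy by_.
have CS := Rintegral_dot_cauchy_schwarz P bpx bpy.
set c := (\int[P]_w _) in CS *.
set Cx := (X in Num.sqrt X * _) in lex *; set Cy := (X in _ * Num.sqrt X) in ley *.
have dot_ge0 p U : 0 <= \int[P]_w \sum_i co p U w 0 i * co p U w 0 i.
  by apply: Rintegral_ge0 => w _; apply: sumr_ge0 => i _; rewrite -expr2 sqr_ge0.
have c_le : `|c| <= Num.sqrt Cx * Num.sqrt Cy.
  rewrite -sqrtrM ?dot_ge0// -sqrtr_sqr ler_wsqrtr// (le_trans CS)//.
  (* Each transported second moment is at most the variance at [mu] or [nu]; in terms of inner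
     products the pointwise comparisons are [px_le] and [py_le]. *)
  apply: ler_pM; rewrite ?dot_ge0//.
    by apply: lex => w; rewrite !onb_coord_inner.
  by apply: ley => w; rewrite !onb_coord_inner.
rewrite -ler_norml normrM normfV (ger0_norm (x := _ * _)) ?mulr_ge0 ?sqrtr_ge0//.
(* If a variance vanishes, the quotient is 0, because the inverse of 0 is 0. *)
have [->|D0] := eqVneq (Num.sqrt Cx * Num.sqrt Cy) 0; first by rewrite invr0 mulr0.
by rewrite ler_pdivrMr ?mul1r// lt_neqAle eq_sym D0 mulr_ge0 ?sqrtr_ge0.
Qed.
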